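(* Let $g\in C^m(\mathbb{R}^3)$ be a scalar function (not necessarily axially symmetric). Let $\iota_i\in\{r,z,\theta\}$ for $i=1,\dots,m$, and let $m_r$ and $m_z$ be the number of indices $i$ with $\iota_i=r$ and $\iota_i=z$, respectively, and let $m_c$ be one half of the number of indices $i$ with $\iota_i=\theta$. Then there is a scalar function $F_{\iota_1,\dots,\iota_m}(r,z,\theta)$ such that $$ \nabla^m g:\mathfrak{E}_{\iota_1}\otimes\cdots\otimes\mathfrak{E}_{\iota_m}= \begin{cases} (2m_c-1)!!\,r^{2m_c}\,\partial_z^{m_z}\partial_r^{m_r}\big(\frac{\partial_r}{r}\big)^{m_c}g+\partial_\theta F_{\iota_1,\dots,\iota_m}(r,z,\theta), & \text{if } m_c \text{ is an integer},\\[1mm] \partial_\theta F_{\iota_1,\dots,\iota_m}(r,z,\theta), & \text{otherwise.} \end{cases} $$ Equivalently, in the orthonormal frame, $$ \nabla^m g:\boldsymbol{e}_{\iota_1}\otimes\cdots\otimes\boldsymbol{e}_{\iota_m}= \begin{cases} (2m_c-1)!!\,\partial_z^{m_z}\partial_r^{m_r}\big(\frac{\partial_r}{r}\big)^{m_c}g+r^{-2m_c}\partial_\theta F_{\iota_1,\dots,\iota_m}(r,z,\theta), & \text{if } m_c \text{ is an integer},\\[1mm] r^{-2m_c}\partial_\theta F_{\iota_1,\dots,\iota_m}(r,z,\theta), & \text{otherwise.} \end{cases} $$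
   Context: Cylindrical coordinates $(r,\theta,z)$ on $\mathbb{R}^3$: $x=(r\cos\theta,r\sin\theta,z)$, with orthonormal frame $\boldsymbol{e}_r=(\cos\theta,\sin\theta,0)$, $\boldsymbol{e}_\theta=(-\sin\theta,\cos\theta,0)$, $\boldsymbol{e}_z=(0,0,1)$ and coordinate (covariant) frame $\mathfrak{E}_r=\boldsymbol{e}_r$, $\mathfrak{E}_\theta=r\boldsymbol{e}_\theta$, $\mathfrak{E}_z=\boldsymbol{e}_z$; identities are understood where $r>0$. $\nabla^m g$ is the $m$-th (Euclidean, covariant) derivative tensor of $g$, and $\nabla^m g:\boldsymbol{a}_1\otimes\cdots\otimes\boldsymbol{a}_m$ denotes its full contraction with the vectors $\boldsymbol{a}_1,\dots,\boldsymbol{a}_m$. The operator $\frac{\partial_r}{r}$ is $g\mapsto\frac1r\partial_r g$. Convention: $(-1)!!=1$. $F_{\iota_1,\dots,\iota_m}$ is a (single-valued) function on $\{r>0\}\subset\mathbb{R}^3$ expressed in cylindrical coordinates, i.e. $2\pi$-periodic in $\theta$. *)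

(* Defs.v *)
From HB Require Import structures.
From mathcomp Require Import all_boot all_order all_algebra.
From mathcomp Require Import all_classical all_reals all_analysis.

Set Implicit Arguments.
Unset Strict Implicit.
Unset Printing Implicit Defensive.

Import Order.TTheory GRing.Theory Num.Theory.
Import numFieldNormedType.Exports.

Local Open Scope ring_scope.

Section Cartesian.
Context {R : realType}.
Implicit Types (g : 'rV[R]_3 -> R) (x : 'rV[R]_3).

Definition vec3 (a b c : R) : 'rV[R]_3 := \row_(j < 3) [:: a; b; c]`_j.

Definition partial (j : 'I_3) g : 'rV[R]_3 -> R := 'D_(delta_mx 0 j) g.

(* [class_C m g] : all iterated partial derivatives of g of order at most m
   exist and are continuous on the whole space. *)
Fixpoint class_C (m : nat) g : Prop :=
  if m is m'.+1 then
    [/\ continuous g,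
        forall (j : 'I_3) x, derivable g x (delta_mx 0 j) &
        forall j : 'I_3, class_C m' (partial j g)]
  else continuous g.

Definition iter_partial (s : seq 'I_3) g : 'rV[R]_3 -> R := foldr partial g s.

(* Full contraction of the m-th derivative tensor of g at x with the vectors
   v_1, ..., v_m : the sum over all multi-indices (a_1, ..., a_m) of
   (partial_{a_1} ... partial_{a_m} g)(x) (v_1)_{a_1} ... (v_m)_{a_m}. *)
Definition nabla_contract (m : nat) g x (v : m.-tuple 'rV[R]_3) : R :=
  \sum_(a : m.-tuple 'I_3)
     iter_partial a g x * \prod_(i < m) (tnth v i) 0 (tnth a i).

End Cartesian.

Inductive cyl_index := idx_r | idx_z | idx_theta.

Definition is_r (i : cyl_index) := if i is idx_r then true else false.
Definition is_z (i : cyl_index) := if i is idx_z then true else false.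
Definition is_theta (i : cyl_index) := if i is idx_theta then true else false.

(* Double factorial.  Truncated subtraction makes (2 * 0 - 1)!! equal to
   0!! = 1, which is the convention (-1)!! = 1. *)
Fixpoint double_fact (n : nat) : nat :=
  if n is n'.+2 then (n * double_fact n')%N else 1%N.

Section Cylindrical.
Context {R : realType}.

(* Functions of cylindrical coordinates take their arguments in the order
   r, z, theta. *)
Implicit Types (G : R -> R -> R -> R) (r z theta : R).

Definition cyl_point r z theta : 'rV[R]_3 :=
  vec3 (r * cos theta) (r * sin theta) z.

Definition in_cyl (g : 'rV[R]_3 -> R) : R -> R -> R -> R :=
  fun r z theta => g (cyl_point r z theta).

Definition d_r G : R -> R -> R -> R :=
  fun r z theta => derive1 (fun s => G s z theta) r.
Definition d_z G : R -> R -> R -> R :=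
  fun r z theta => derive1 (fun s => G r s theta) z.
Definition d_theta G : R -> R -> R -> R :=
  fun r z theta => derive1 (fun s => G r z s) theta.

Definition d_r_over_r G : R -> R -> R -> R :=
  fun r z theta => r^-1 * d_r G r z theta.

Definition ortho_frame theta (i : cyl_index) : 'rV[R]_3 :=
  match i with
  | idx_r => vec3 (cos theta) (sin theta) 0
  | idx_theta => vec3 (- sin theta) (cos theta) 0
  | idx_z => vec3 0 0 1
  end.

Definition coord_frame r theta (i : cyl_index) : 'rV[R]_3 :=
  match i with
  | idx_theta => r *: ortho_frame theta idx_theta
  | _ => ortho_frame theta i
  end.

End Cylindrical.

(* Main.v *)
(* Write S(b, n) for the orthonormal component of the derivative tensor of
   (d/dz)^a g with b indices r and n indices theta; the order of the indices is
   irrelevant because partial derivatives commute.  Differentiating S(b, n) along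
   the circle, where e_r' = e_theta and e_theta' = - e_r, gives
     d_theta S(b, n) = r S(b, n+1) + b S(b-1, n+1) - n S(b+1, n-1).
   By Leibniz' rule the functions d_r^b (d_r / r)^c d_z^a g, weighted by
   (2c-1)!!, satisfy the same recursion in (b, n = 2c) without the term
   d_theta S(b, n), and agree with S(b, 0) for n = 0.  Hence S(b, n) and its main
   term differ by d_theta of a linear combination of the functions S, with
   coefficients depending on r only. *)
Require Import Defs.
From mathcomp Require Import all_boot all_order all_algebra.
From mathcomp Require Import all_classical all_reals all_analysis.
From mathcomp Require Import ring.

Set Implicit Arguments.
Unset Strict Implicit.
Unset Printing Implicit Defensive.

Import Order.TTheory GRing.Theory Num.Theory.
Import numFieldNormedType.Exports.

Local Open Scope classical_set_scope.
Local Open Scope ring_scope.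

(** * Mean values and the symmetry of second derivatives *)

Section MeanValue.
Context {R : realType} {V : normedModType R}.
Implicit Types (f : V -> R) (x u v : V).

Lemma is_derive_line f x v (s : R) : derivable f (s *: v + x) v ->
  is_derive s 1 (fun t : R => f (t *: v + x)) ('D_v f (s *: v + x)).
Proof.
have quotE : (fun h : R => h^-1 *: (((fun t => f (t *: v + x)) \o shift s) (h *: 1)
      - f (s *: v + x))) =
    (fun h => h^-1 *: ((f \o shift (s *: v + x)) (h *: v) - f (s *: v + x))).
  by apply/funext => h /=; rewrite [h *: 1]mulr1 scalerDl addrA.
by move=> df; split; rewrite /derivable /derive quotE.
Qed.

(** The mean value theorem on the line through [x] in direction [v]; bounding |c| by |t| treats both
    signs of [t] at once. *)
Lemma mean_value_direction f x v (t : R) : (forall y, derivable f y v) ->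
  exists2 c, `|c| <= `|t| & f (t *: v + x) - f x = t * 'D_v f (c *: v + x).
Proof.
move=> df; pose phi (s : R) := f (s *: v + x).
have dphi (s : R) : is_derive s 1 phi ('D_v f (s *: v + x)) by exact: is_derive_line.
have cphi (a b : R) : {within `[a, b], continuous phi}.
  by apply: derivable_within_continuous => s _; apply: ex_derive.
have phi0 : phi 0 = f x by rewrite /phi scale0r add0r.
case: (leP 0 t) => t0.
  have [c] := MVT_segment t0 (fun s _ => dphi s) (cphi _ _).
  rewrite in_itv /= => /andP[c0 ct] e; exists c; first by rewrite !ger0_norm.
  by rewrite -phi0 -/(phi t) e subr0 mulrC.
have [c] := MVT_segment (ltW t0) (fun s _ => dphi s) (cphi _ _).
rewrite in_itv /= => /andP[tc c0] e; exists c.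
  by rewrite (ltr0_norm t0) ler0_norm// lerN2.
by rewrite -phi0 -/(phi t) -[LHS]opprB e sub0r mulrN opprK mulrC.
Qed.

(** Two mean values: one in direction [u] for the increment [f (h *: v + y) - f y], then one in
    direction [v] for ['D_u f]. *)
Lemma second_difference f u v x (h : R) :
  (forall y, derivable f y u) -> (forall y, derivable ('D_u f) y v) ->
  exists c d, [/\ `|c| <= `|h|, `|d| <= `|h| &
    f (h *: v + (h *: u + x)) - f (h *: v + x) - (f (h *: u + x) - f x) =
    h * (h * 'D_v ('D_u f) (d *: v + (c *: u + x)))].
Proof.
move=> du duv.
pose p y := f (h *: v + y) - f y.
have dsh y : is_derive y u (fun y => f (h *: v + y)) ('D_u f (h *: v + y)).
  have quotE :
    (fun k : R => k^-1 *: (((fun y => f (h *: v + y)) \o shift y) (k *: u)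
      - f (h *: v + y))) =
    (fun k => k^-1 *: ((f \o shift (h *: v + y)) (k *: u) - f (h *: v + y))).
    by apply/funext => k /=; rewrite addrCA.
  by have dy := du (h *: v + y); split; rewrite /derivable /derive quotE.
have dp y : is_derive y u p ('D_u f (h *: v + y) - 'D_u f y).
  by apply: is_deriveB; apply: derivableP.
have [c ch e] := mean_value_direction x h (fun y => @ex_derive _ _ _ _ _ _ _ (dp y)).
have [d dh e'] := mean_value_direction (c *: u + x) h duv.
exists c, d; split => //.
move: e; rewrite (@derive_val _ _ _ _ _ _ _ (dp _)) e' => <-.
by rewrite /p; ring.
Qed.

(** The values at [y] and [z] tend to those at [x]. Two distinct nearby points are allowed because
    the two orders of differentiation produce different intermediate points. *)
Lemma eq_of_continuous (A B : V -> R) x :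
  {for x, continuous A} -> {for x, continuous B} ->
  (forall d : R, 0 < d ->
     exists y z, [/\ `|x - y| < d, `|x - z| < d & A y = B z]) ->
  A x = B x.
Proof.
move=> cA cB AB; apply/eqP; rewrite -subr_eq0 -normr_le0; apply/ler_addgt0Pr => e e0.
rewrite add0r.
have e20 : 0 < e / 2 by rewrite divr_gt0.
have [d1 /= d10] := (nbhs_ballP _ _).1 ((cvgrPdist_lt _ _).1 cA _ e20).
have [d2 /= d20] := (nbhs_ballP _ _).1 ((cvgrPdist_lt _ _).1 cB _ e20).
rewrite -ball_normE => Bd Ad.
have [|y [z [+ + yz]]] := AB (Num.min d1 d2); first by rewrite lt_min d10.
rewrite !lt_min => /andP[/Ad /= ly _] /andP[_ /Bd /= lz].
have -> : A x - B x = (A x - A y) - (B x - B z) by rewrite yz; ring.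
by rewrite [e]splitr (le_trans (ler_normB _ _))// ltW// ltrD.
Qed.

(* The second difference of [f] over the parallelogram spanned by [h u] and
   [h v] equals both [h^2 D_v D_u f] and [h^2 D_u D_v f] at nearby points. *)
Lemma derive_swap f u v x :
  (forall y, derivable f y u) -> (forall y, derivable f y v) ->
  (forall y, derivable ('D_u f) y v) -> (forall y, derivable ('D_v f) y u) ->
  {for x, continuous ('D_v ('D_u f))} -> {for x, continuous ('D_u ('D_v f))} ->
  'D_v ('D_u f) x = 'D_u ('D_v f) x.
Proof.
move=> du dv duv dvu cuv cvu.
apply: (eq_of_continuous cuv cvu) => d d0.
(* The summand 1 keeps [K] positive when [u = v = 0]; the choice of [h] gives h K = d / 2 < d. *)
pose K := `|u| + `|v| + 1.
have K0 : 0 < K by rewrite ltr_wpDl// addr_ge0.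
pose h := d / K / 2.
have h0 : 0 < h by rewrite !divr_gt0.
have hn : h != 0 by rewrite gt_eqF.
have small a b (s t : R) : `|s| <= `|h| -> `|t| <= `|h| ->
    `|a| + `|b| <= `|u| + `|v| -> `|x - (t *: b + (s *: a + x))| < d.
  move=> sh th ab; rewrite addrA opprD addrCA subrr addr0 normrN.
  apply: le_lt_trans (ler_normD _ _) _; rewrite !normrZ.
  apply: (@le_lt_trans _ _ (`|h| * (`|b| + `|a|))).
    by rewrite mulrDr lerD// ler_wpM2r.
  rewrite (gtr0_norm h0) [`|b| + _]addrC.
  apply: (@le_lt_trans _ _ (h * K)).
    by rewrite ler_pM2l// (le_trans ab)// lerDl.
  by rewrite /h mulrAC divfK ?gt_eqF// ltr_pdivrMr// ltr_pMr// ltr1n.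
have [c1 [e1 [c1h e1h E1]]] := second_difference x h du duv.
have [c2 [e2 [c2h e2h E2]]] := second_difference x h dv dvu.
exists (e1 *: v + (c1 *: u + x)), (e2 *: u + (c2 *: v + x)).
split; [exact: small|by apply: small; rewrite // addrC|].
apply: (mulfI hn); apply: (mulfI hn); rewrite -[LHS]E1 -[RHS]E2.
by rewrite [h *: v + (h *: u + x)]addrCA; ring.
Qed.

End MeanValue.

(** * Chain rule along curves from continuous partial derivatives *)

Section ContinuousPartials.
Context {R : realType} {n : nat}.
Implicit Types (f : 'rV[R]_n -> R) (x h : 'rV[R]_n).

Lemma le_coord_norm h (j : 'I_n) : `|h 0 j| <= `|h|.
Proof.
rewrite [leRHS]/Num.norm/= mx_normrE.
exact: (le_bigmax _ (fun ij => `|h ij.1 ij.2|) (0, j)).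
Qed.

Lemma norm_rV_le h (e : R) : 0 <= e -> (forall j, `|h 0 j| <= e) -> `|h| <= e.
Proof.
move=> e0 he; rewrite [leLHS]/Num.norm/= mx_normrE bigmax_le// => -[i j] _ /=.
by rewrite ord1.
Qed.

(** Moving from [x] to [h + x] one coordinate at a time telescopes the increment into mean values
    along the axes. The norm is the maximum norm, so the intermediate points stay within |h| of
    [x]. *)
Lemma increment_partials f x h :
  (forall j y, derivable f y (delta_mx 0 j)) ->
  exists2 xi : 'I_n -> 'rV[R]_n, forall k, `|xi k| <= `|h| &
    f (h + x) - f x = \sum_(k < n) h 0 k * 'D_(delta_mx 0 k) f (xi k + x).
Proof.
move=> df.
pose trunc k : 'rV[R]_n := \row_(j < n) (if (j < k)%N then h 0 j else 0).
have trunc0 : trunc 0 = 0 by apply/rowP => j; rewrite !mxE.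
have truncn : trunc n = h by apply/rowP => j; rewrite !mxE ltn_ord.
have truncS (k : 'I_n) : trunc k.+1 = h 0 k *: delta_mx 0 k + trunc k.
  apply/rowP => j; rewrite !mxE eqxx /= ltnS leq_eqVlt -(inj_eq val_inj) /=.
  by case: ltngtP => [jk|jk|/val_inj->]; rewrite ?mulr0 ?mulr1 ?addr0 ?add0r.
have step (k : 'I_n) : exists2 y, `|y| <= `|h| &
    f (trunc k.+1 + x) - f (trunc k + x) = h 0 k * 'D_(delta_mx 0 k) f (y + x).
  have [c ch e] := mean_value_direction (trunc k + x) (h 0 k) (df k).
  exists (c *: delta_mx 0 k + trunc k); last by rewrite truncS -!addrA e.
  apply: norm_rV_le => // j; rewrite !mxE eqxx /=.
  case: (eqVneq j k) => [->|_]; rewrite ?ltnn ?mulr1 ?mulr0 ?addr0 ?add0r.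
    exact: le_trans ch (le_coord_norm _ _).
  by case: ifP => _; rewrite ?normr0// le_coord_norm.
have [xi xih xiE] := fin_all_exists2 step.
exists xi => //; rewrite -(eq_bigr _ (fun k _ => xiE k)).
rewrite -(big_mkord xpredT (fun k => f (trunc k.+1 + x) - f (trunc k + x))).
by rewrite telescope_sumr// trunc0 truncn add0r.
Qed.

(** Divided by s, the increment is a sum of coordinate quotients times partial derivatives at
    intermediate points, which converge to [gamma t]. *)
Lemma is_derive_curve f (gamma : R -> 'rV[R]_n) (v : 'rV[R]_n) (t : R) :
  (forall j y, derivable f y (delta_mx 0 j)) ->
  (forall j, {for gamma t, continuous ('D_(delta_mx 0 j) f)}) ->
  (forall j, is_derive t 1 (fun s => gamma s 0 j) (v 0 j)) ->
  is_derive t 1 (f \o gamma)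
    (\sum_(j < n) v 0 j * 'D_(delta_mx 0 j) f (gamma t)).
Proof.
move=> df cf dg.
have [xi xi_le xiE] : exists2 xi : R -> 'I_n -> 'rV[R]_n,
    forall s k, `|xi s k| <= `|gamma (s + t) - gamma t| &
    forall s, f (gamma (s + t)) - f (gamma t) = \sum_(k < n)
      (gamma (s + t) 0 k - gamma t 0 k) * 'D_(delta_mx 0 k) f (xi s k + gamma t).
  have /choice[xi xiP] (s : R) : exists xi : 'I_n -> 'rV[R]_n,
      (forall k, `|xi k| <= `|gamma (s + t) - gamma t|) /\
      f (gamma (s + t)) - f (gamma t) = \sum_(k < n)
        (gamma (s + t) 0 k - gamma t 0 k) * 'D_(delta_mx 0 k) f (xi k + gamma t).
    have [xi xi_le] := increment_partials (gamma t) (gamma (s + t) - gamma t) df.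
    rewrite subrK => ->; exists xi; split=> //.
    by apply: eq_bigr => k _; rewrite !mxE.
  by exists xi => s; have [] := xiP s.
have gcont : gamma (s + t) @[s --> (0 : R)] --> gamma t.
  have gder : derivable gamma t 1.
    by apply/derivable_mxP => i j; rewrite ord1; apply: ex_derive.
  have := differentiable_continuous ((derivable1_diffP _ _).1 gder).
  by rewrite continuous_shift /prop_for /continuous_at /= add0r.
have quot_cvg (k : 'I_n) :
    s^-1 * (gamma (s + t) 0 k - gamma t 0 k) @[s --> (0 : R)^'] --> v 0 k.
  have [gk <-] := dg k.
  rewrite (_ : (fun s => _) = (fun s : R => s^-1 *: (((fun s => gamma s 0 k) \o shift t)
    (s *: 1) - gamma t 0 k))); first exact: gk.
  by apply/funext => s /=; rewrite [s *: 1]mulr1.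
have partial_cvg (k : 'I_n) :
    'D_(delta_mx 0 k) f (xi s k + gamma t) @[s --> (0 : R)^'] -->
    'D_(delta_mx 0 k) f (gamma t).
  have xi_cvg : xi s k + gamma t @[s --> (0 : R)] --> gamma t.
    apply/cvgrPdist_lt => e e0.
    near=> s; rewrite opprD addrCA subrr addr0 normrN.
    rewrite (le_lt_trans (xi_le s k))// distrC; near: s.
    exact: (cvgrPdist_lt _ _).1 gcont _ e0.
  exact: cvg_within_filter (continuous_cvg _ (cf k) xi_cvg).
have quotient_cvg :
    s^-1 *: ((f \o gamma \o shift t) (s *: 1) - (f \o gamma) t) @[s --> (0 : R)^']
    --> \sum_(j < n) v 0 j * 'D_(delta_mx 0 j) f (gamma t).
  rewrite (_ : (fun s => _) = (fun s : R => \sum_(k < n)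
    s^-1 * (gamma (s + t) 0 k - gamma t 0 k) * 'D_(delta_mx 0 k) f (xi s k + gamma t))).
    apply: cvg_big => [|k _]; first exact: add_continuous.
    exact: cvgM.
  apply/funext => s /=; rewrite [s *: 1]mulr1 xiE scaler_sumr.
  by apply: eq_bigr => k _; rewrite -mulrA.
split; first by apply/cvg_ex; exists (\sum_(j < n) v 0 j * 'D_(delta_mx 0 j) f (gamma t)).
exact: cvg_lim.
Unshelve. all: by end_near. Qed.

End ContinuousPartials.

(** * Contractions of the derivative tensor *)

Section Contraction.
Context {R : realType}.
Implicit Types (g : 'rV[R]_3 -> R) (x u v : 'rV[R]_3) (vs : seq 'rV[R]_3).

Lemma class_C_continuous m g : class_C m g -> continuous g.
Proof. by case: m => [//|m [+ _ _]]. Qed.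

Lemma class_C_derivable m g (j : 'I_3) x :
  class_C m.+1 g -> derivable g x (delta_mx 0 j).
Proof. by move=> [_ + _]; exact. Qed.

Lemma class_C_partial m g (j : 'I_3) : class_C m.+1 g -> class_C m (partial j g).
Proof. by move=> [_ _]; exact. Qed.

Lemma class_CS m g : class_C m.+1 g -> class_C m g.
Proof.
elim: m g => [|m IHm] g gC; first exact: class_C_continuous gC.
split=> [|j x|j]; first exact: class_C_continuous gC.
  exact: class_C_derivable gC.
exact/IHm/class_C_partial.
Qed.

Lemma class_C_le m n g : (m <= n)%N -> class_C n g -> class_C m g.
Proof.
move=> /subnK <-; elim: (n - m)%N => [//|k IHk] gC.
exact/IHk/class_CS.
Qed.

Lemma partial_swap m g (i j : 'I_3) :
  class_C m.+2 g -> partial i (partial j g) = partial j (partial i g).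
Proof.
move=> gC; have dg k y := @class_C_derivable m.+1 g k y gC.
have pC k := class_C_partial k gC.
have cpp k l := class_C_continuous (class_C_partial l (pC k)).
apply/funext => x; apply: derive_swap.
- exact: dg.
- exact: dg.
- by move=> y; exact: class_C_derivable (pC j).
- by move=> y; exact: class_C_derivable (pC i).
- exact: cpp.
- exact: cpp.
Qed.

(** [iter_partial] applies the head of the list outermost, [tensor_contract] innermost; commuting
    derivatives reconciles them. *)
Lemma iter_partial_cons (s : seq 'I_3) (j : 'I_3) g :
  class_C (size s).+1 g -> iter_partial (j :: s) g = iter_partial s (partial j g).
Proof.
elim: s j g => [//|i s IHs] j g gC.
have iC := class_C_partial i gC; have jC := class_C_partial j gC.
have consE k t h : iter_partial (k :: t) h = partial k (iter_partial t h) by [].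
rewrite consE (IHs i g (class_CS gC)) -consE (IHs j _ iC) (partial_swap j i gC).
by rewrite -(IHs i _ jC).
Qed.

(** Differentiating [g] first lets inductions on [vs] run with [g] generalised, at the cost of one
    order of smoothness per slot. *)
Fixpoint tensor_contract g vs x : R :=
  if vs is v :: vs' then \sum_(j < 3) v 0 j * tensor_contract (partial j g) vs' x
  else g x.

Lemma tensor_contract_cons g v vs x : tensor_contract g (v :: vs) x =
  \sum_(j < 3) v 0 j * tensor_contract (partial j g) vs x.
Proof. by []. Qed.

Lemma nabla_contractE m g x (v : m.-tuple 'rV[R]_3) :
  class_C m g -> nabla_contract g x v = tensor_contract g v x.
Proof.
elim: m g v => [|m IHm] g v gC.
  rewrite tuple0 /nabla_contract (bigD1 [tuple])//= big_ord0 mulr1.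
  by rewrite big1 ?addr0// => a; rewrite tuple0.
case/tupleP: v => u v /=; rewrite /nabla_contract.
rewrite (reindex (fun p : 'I_3 * m.-tuple 'I_3 => cons_tuple p.1 p.2)) /=; last first.
  exists (fun a => (thead a, [tuple of behead a])) => [[j a] _|a _] /=.
    by congr (_, _); exact: val_inj.
  by rewrite [RHS]tuple_eta; exact: val_inj.
rewrite -(pair_big xpredT xpredT (fun j (a : m.-tuple 'I_3) =>
  iter_partial (j :: a) g x *
  \prod_(i < m.+1) (tnth [tuple of u :: v] i) 0 (tnth (cons_tuple j a) i))) /=.
apply: eq_bigr => j _; rewrite -IHm; last exact: class_C_partial.
rewrite /nabla_contract mulr_sumr; apply: eq_bigr => a _.
rewrite big_ord_recl /= !tnth0 mulrCA.
have -> : partial j (foldr partial g a) = iter_partial a (partial j g).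
  by rewrite -iter_partial_cons ?size_tuple.
congr (_ * (_ * _)).
by apply: eq_bigr => i _; rewrite !tnthS.
Qed.

Lemma contract_swap g u v vs x : class_C (size vs).+2 g ->
  tensor_contract g (u :: v :: vs) x = tensor_contract g (v :: u :: vs) x.
Proof.
move=> gC /=; under eq_bigr do rewrite mulr_sumr.
rewrite exchange_big /=; apply: eq_bigr => j _; rewrite mulr_sumr.
by apply: eq_bigr => i _; rewrite mulrCA (partial_swap _ _ gC).
Qed.

Lemma is_derive_sumr n (F : 'I_n -> R -> R) (dF : 'I_n -> R) (t : R) :
  (forall j, is_derive t 1 (F j) (dF j)) ->
  is_derive t 1 (fun s => \sum_(j < n) F j s) (\sum_(j < n) dF j).
Proof.
move=> dFj; rewrite (_ : (fun s => _) = \sum_(j < n) F j); first exact: is_derive_sum.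
by apply/funext => s; rewrite fct_sumE.
Qed.

(** The velocity of [gamma] fills a new slot. In the induction the swap puts the fixed vector [w]
    back in front, so each summand is an instance for [partial j g]. *)
Lemma is_derive_contract g vs (gamma : R -> 'rV[R]_3) v (t : R) :
  class_C (size vs).+1 g ->
  (forall j, is_derive t 1 (fun s => gamma s 0 j) (v 0 j)) ->
  is_derive t 1 (fun s => tensor_contract g vs (gamma s))
    (tensor_contract g (v :: vs) (gamma t)).
Proof.
elim: vs g => [|w vs IHvs] g gC dgamma.
  apply: is_derive_curve => // j; first by move=> y; exact: class_C_derivable gC.
  exact: (class_C_continuous (class_C_partial j gC)).
rewrite contract_swap//=; apply: is_derive_sumr => j.
apply: is_deriveZ; apply: IHvs => //; exact: class_C_partial.
Qed.

End Contraction.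

(** * The operator (1/r) d/dr *)

Section RadialIteration.
Context {R : realType}.
Implicit Types (r t : R) (f : nat -> R).

(* If [f b] is the b-th derivative of a function at r, then [radial_iter r f c b]
   is the b-th derivative at r of its image under the c-th iterate of
   [(1/r) d/dr]: the recursion solves Leibniz' rule for d^b (r (1/r) d/dr h). *)
Fixpoint radial_iter r f (c : nat) : nat -> R :=
  if c is c'.+1 then
    fix iter_b b := r^-1 * (radial_iter r f c' b.+1
                            - (if b is b'.+1 then b%:R * iter_b b' else 0))
  else f.

(** At [b = 0] the zero factor removes the term with the truncated index [b.-1]. *)
Lemma radial_iterE r f c b : radial_iter r f c.+1 b =
  r^-1 * (radial_iter r f c b.+1 - b%:R * radial_iter r f c.+1 b.-1).
Proof. by case: b => [|b] //=; rewrite mul0r. Qed.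

Lemma is_derive_divl (h : R -> R) dh r : r != 0 -> is_derive r 1 h dh ->
  is_derive r 1 (fun s => s^-1 * h s) (r^-1 * (dh - r^-1 * h r)).
Proof.
move=> r0 dhr.
have dinv : is_derive r 1 (fun s : R => s^-1) (- r ^- 2 *: 1).
  exact: (is_deriveV (f := id)).
have dM := is_deriveM dinv dhr.
apply: (is_derive_eq dM).
by rewrite /GRing.scale /= expr2 invfM; ring.
Qed.

(** Here s enters both as the radius and through [F]. Entry [b] of iterate [c] uses [b + c]
    derivatives, and its own differentiation one more. *)
Lemma is_derive_radial_iter (F : nat -> R -> R) M c b r : r != 0 ->
  (forall k, (k < M)%N -> is_derive r 1 (F k) (F k.+1 r)) -> (b + c < M)%N ->
  is_derive r 1 (fun s => radial_iter s (F^~ s) c b) (radial_iter r (F^~ r) c b.+1).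
Proof.
move=> r0 dF; elim: c b => [|c IHc] b; first by rewrite addn0; exact: dF.
elim: b => [|b IHb] bcM.
  have dh := IHc 1%N bcM; rewrite 2!radial_iterE mul1r mul0r subr0.
  rewrite (_ : (fun s => _) = fun s => s^-1 * radial_iter s (F^~ s) c 1).
    exact: is_derive_divl dh.
  by apply/funext => s; rewrite radial_iterE mul0r subr0.
have dh1 := IHc b.+2; have dh2 := IHb _.
rewrite (_ : (fun s => _) = fun s => s^-1 * (radial_iter s (F^~ s) c b.+2 -
    b.+1%:R * radial_iter s (F^~ s) c.+1 b)); last first.
  by apply/funext => s; rewrite radial_iterE.
apply: is_derive_eq.
  apply: is_derive_divl => //; apply: is_deriveB; first by apply: dh1; rewrite addSn -addnS.
  by apply: is_deriveZ; apply: dh2; rewrite ltnW.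
(* The term h(r) / r of the quotient rule is the entry [b.+1], which raises the factor [b.+1] to
   [b.+2]. *)
rewrite (radial_iterE _ _ _ b.+2) (radial_iterE _ _ _ b.+1) /= /GRing.scale /=.
by rewrite -[b.+2%:R]natr1; ring.
Qed.

(** At fixed [r] the entries are linear in [f] with constant coefficients, so a parameter derivative
    passes inside. *)
Lemma is_derive_radial_iter_param (F F' : nat -> R -> R) M r t c b :
  (forall k, (k <= M)%N -> is_derive t 1 (F k) (F' k t)) -> (b + c <= M)%N ->
  is_derive t 1 (fun s => radial_iter r (F^~ s) c b) (radial_iter r (F'^~ t) c b).
Proof.
move=> dF; elim: c b => [|c IHc] b; first by rewrite addn0; exact: dF.
elim: b => [|b IHb] bcM.
  rewrite radial_iterE mul0r subr0.
  rewrite (_ : (fun s => _) = fun s => r^-1 * radial_iter r (F^~ s) c 1).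
    by apply: is_deriveZ; apply: IHc.
  by apply/funext => s; rewrite radial_iterE mul0r subr0.
rewrite radial_iterE.
rewrite (_ : (fun s => _) = fun s => r^-1 * (radial_iter r (F^~ s) c b.+2 -
    b.+1%:R * radial_iter r (F^~ s) c.+1 b)); last first.
  by apply/funext => s; rewrite radial_iterE.
apply: is_deriveZ; apply: is_deriveB; first by apply: IHc; rewrite addSn -addnS.
by apply: is_deriveZ; apply: IHb; rewrite ltnW.
Qed.

(** At [n = 0] the truncated predecessor encodes (-1)!! = 1. *)
Lemma double_fact_odd n : ~~ odd n -> double_fact n.+1 = (n.+1 * double_fact n.-1)%N.
Proof. by case: n => [|[|n]]. Qed.

Lemma radial_iterS r f c b : r != 0 ->
  r * radial_iter r f c.+1 b =
  radial_iter r f c b.+1 - b%:R * radial_iter r f c.+1 b.-1.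
Proof. by move=> r0; rewrite [in LHS]radial_iterE mulVKf. Qed.

(* [S b n] stands for the component with [b] indices r and [n] indices theta. *)
Lemma theta_derivative_decomposition (S : nat -> nat -> R -> R) m r T : r != 0 ->
  (forall b n, periodic (S b n) T) ->
  (forall b n t, (b + n < m)%N -> is_derive t 1 (S b n)
     (r * S b n.+1 t + b%:R * S b.-1 n.+1 t - n%:R * S b.+1 n.-1 t)) ->
  forall b n, (b + n <= m)%N -> exists2 F : R -> R, periodic F T &
    forall t, is_derive t 1 F (S b n t -
      (if ~~ odd n then (double_fact n.-1)%:R * radial_iter r (fun k => S k 0%N t) n./2 b
       else 0)).
Proof.
(* The recursion reduces (b, n+1) to (b+1, n-1) and (b-1, n+1): hence induction on [n], then on
   [b]. *)
move=> r0 SP dS b n; elim/ltn_ind: n b => -[|n] IHn.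
  move=> b _; exists (cst 0) => [t|t] /=; first by [].
  by rewrite mul1r subrr; exact: is_derive_cst.
pose M b n t := if ~~ odd n then
  (double_fact n.-1)%:R * radial_iter r (fun k => S k 0%N t) n./2 b else 0.
(* The main terms satisfy the recursion of [S] without the theta derivative; the orders n+1 and n-1
   that occur share their parity. *)
have MS b t : r * M b n.+1 t = n%:R * M b.+1 n.-1 t - b%:R * M b.-1 n.+1 t.
  rewrite /M; case: n {IHn} => [|n]; first by rewrite /= mul0r !mulr0 subr0.
  have -> : odd n.+2 = odd n by rewrite /= negbK.
  rewrite !succnK; case: ifP => // on; last by rewrite !mulr0 subr0.
  rewrite double_fact_odd// -[n.+2./2]/(n./2.+1) natrM.
  set X := radial_iter _ _ _.+1 b.
  transitivity (n.+1%:R * (double_fact n.-1)%:R * (r * X)); first by ring.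
  by rewrite /X radial_iterS//; ring.
(* Serves the zero coefficients at [n = 0] and [b = 0], where a truncated predecessor stands for no
   actual term. *)
have zeroP (h : R -> R) : exists2 F : R -> R, periodic F T &
    forall t, is_derive t 1 F (0%:R * h t).
  by exists (cst 0) => // t; rewrite mul0r; exact: is_derive_cst.
have scaleP k (h : R -> R) :
    (exists2 F : R -> R, periodic F T & forall t, is_derive t 1 F (h t)) ->
    exists2 F : R -> R, periodic F T & forall t, is_derive t 1 F (k%:R * h t).
  move=> [F FP dF]; exists (fun t => k%:R * F t) => t; first by rewrite FP.
  exact: is_deriveZ.
elim/ltn_ind => b IHb bnm.
have [F1 F1P dF1] : exists2 F : R -> R, periodic F T &
    forall t, is_derive t 1 F (n%:R * (S b.+1 n.-1 t - M b.+1 n.-1 t)).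
  case: (posnP n) => [->|n0]; first exact: zeroP.
  by apply/scaleP/IHn; rewrite ?prednK// addSn -addnS prednK// ltnW -?addnS.
have [F2 F2P dF2] : exists2 F : R -> R, periodic F T &
    forall t, is_derive t 1 F (b%:R * (S b.-1 n.+1 t - M b.-1 n.+1 t)).
  case: (posnP b) => [->|b0]; first exact: zeroP.
  by apply/scaleP/IHb; rewrite ?prednK// (leq_trans _ bnm)// leq_add2r leq_pred.
(* Subtracting the two recursions gives r (S - M)(b, n+1) = d_theta S(b, n) + n (S - M)(b+1, n-1) -
   b (S - M)(b-1, n+1), where the weighted differences have primitives [F1] and [F2]. *)
exists (fun t => r^-1 * (S b n t + F1 t - F2 t)) => t.
  by rewrite SP F1P F2P.
have dSt := dS b n t; rewrite -addnS in dSt.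
apply: (is_derive_eq (is_deriveZ r^-1 (is_deriveB (is_deriveD (dSt bnm) (dF1 t)) (dF2 t)))).
rewrite -[X in _ = _ - X]/(M b n.+1 t) -[LHS]/(_ * _).
by apply: (mulfI r0); rewrite mulVKf// [RHS]mulrBr MS; ring.
Qed.

End RadialIteration.

(** * Components in the cylindrical frame *)

Section CylindricalComponents.
Context {R : realType}.
Implicit Types (g : 'rV[R]_3 -> R) (r z t : R).

Lemma class_C_iter_partial m a (j : 'I_3) g :
  class_C (a + m) g -> class_C m (iter a (partial j) g).
Proof.
elim: a m => [//|a IHa] m gC /=; apply: class_C_partial.
by apply: IHa; rewrite addnS.
Qed.

Lemma iter_partial_partial a (i j : 'I_3) g : class_C a.+1 g ->
  iter a (partial i) (partial j g) = partial j (iter a (partial i) g).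
Proof.
elim: a => [//|a IHa] gC /=; rewrite IHa; last exact: class_CS.
by apply: (@partial_swap _ 0); apply: class_C_iter_partial; rewrite addn2.
Qed.

Lemma contractZ g (k : R) v vs x :
  tensor_contract g (k *: v :: vs) x = k * tensor_contract g (v :: vs) x.
Proof. by rewrite /= mulr_sumr; apply: eq_bigr => j _; rewrite mxE mulrA. Qed.

Lemma contract_ez g t vs x :
  tensor_contract g (ortho_frame t idx_z :: vs) x = tensor_contract (partial ord_max g) vs x.
Proof.
rewrite /= (bigD1 ord_max)//= big1 => [|j jn].
  by rewrite mxE mul1r addr0.
by rewrite mxE; case: j jn => -[|[|[|//]]] p //= jn; rewrite mul0r.
Qed.

(** Adjacent swaps carry [v] past a block of equal vectors; this is what sorts the index list into r
    before theta. *)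
Lemma contract_nseq g k u v vs x : class_C (k + (size vs).+1) g ->
  tensor_contract g (v :: nseq k u ++ vs) x = tensor_contract g (nseq k u ++ v :: vs) x.
Proof.
elim: k g => [//|k IHk] g gC.
rewrite contract_swap; last by rewrite size_cat size_nseq -addnS.
by apply: eq_bigr => j _; congr (_ * _); apply: IHk; exact: class_C_partial.
Qed.

Definition cyl_contract g (s : seq cyl_index) r z t : R :=
  tensor_contract g (map (ortho_frame t) s) (cyl_point r z t).

(** The S(b, n) of the opening comment, with [g] standing for the function already differentiated in
    z; r before theta is the normal form. *)
Definition cyl_component g (b n : nat) : R -> R -> R -> R :=
  cyl_contract g (nseq b idx_r ++ nseq n idx_theta).

(** Insertion of the head into the sorted tail: z becomes a partial derivative, since e_z is a
    constant basis vector; r is already in place; theta moves past the r block. *)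
Lemma cyl_contractE g (s : seq cyl_index) r z t : class_C (size s) g ->
  cyl_contract g s r z t =
  cyl_component (iter (count is_z s) (partial ord_max) g)
    (count is_r s) (count is_theta s) r z t.
Proof.
have szE s' : (size s' = count is_z s' + (count is_r s' + count is_theta s'))%N.
  by elim: s' => //= -[] s' ->; rewrite /= ?add0n ?add1n ?addnS ?addSn.
elim: s g => [//|i s IHs] g gC.
have -> : cyl_contract g (i :: s) r z t =
    tensor_contract (iter (count is_z s) (partial ord_max) g)
    (map (ortho_frame t)
      (i :: nseq (count is_r s) idx_r ++ nseq (count is_theta s) idx_theta))
    (cyl_point r z t).
  apply: eq_bigr => j _; congr (_ * _).
  apply: (etrans (IHs _ (class_C_partial j gC))).
  rewrite iter_partial_partial//; apply: class_C_le gC.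
  by rewrite /= ltnS szE leq_addr.
rewrite /cyl_component /cyl_contract.
case: i gC => gC; rewrite map_cons ?contract_ez//.
rewrite !map_cat !map_nseq contract_nseq//; apply: class_C_iter_partial.
by move: gC; rewrite /= szE size_nseq !addnS.
Qed.

Lemma cyl_component_thetaS g b n r z t : class_C (b + n).+1 g ->
  tensor_contract g
    (ortho_frame t idx_theta
      :: map (ortho_frame t) (nseq b idx_r ++ nseq n idx_theta))
    (cyl_point r z t) = cyl_component g b n.+1 r z t.
Proof.
move=> gC; rewrite /cyl_component /cyl_contract !map_cat !map_nseq contract_nseq//.
by rewrite size_nseq addnS.
Qed.

Lemma contract_coord_frame g (s : seq cyl_index) r t x :
  tensor_contract g (map (coord_frame r t) s) x =
  r ^+ count is_theta s * tensor_contract g (map (ortho_frame t) s) x.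
Proof.
elim: s g => [|i s IHs] g; first by rewrite mul1r.
have E v : tensor_contract g (v :: map (coord_frame r t) s) x =
    r ^+ count is_theta s * tensor_contract g (v :: map (ortho_frame t) s) x.
  by rewrite !tensor_contract_cons mulr_sumr; apply: eq_bigr => j _; rewrite IHs mulrCA.
rewrite [LHS]E; case: i => //.
rewrite -[coord_frame r t idx_theta]/(r *: ortho_frame t idx_theta).
by rewrite contractZ mulrCA mulrA -exprS.
Qed.

(** * Derivatives of the frame and of the components *)

Lemma is_derive_vec3 (a b c : R -> R) (da db dc t : R) (j : 'I_3) :
  is_derive t 1 a da -> is_derive t 1 b db -> is_derive t 1 c dc ->
  is_derive t 1 (fun s : R => vec3 (a s) (b s) (c s) 0 j) (vec3 da db dc 0 j).
Proof.
move=> ha hb hc; rewrite mxE.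
rewrite (_ : (fun s => _) = fun s : R => [:: a s; b s; c s]`_j).
  by case: j => -[|[|[|]]].
by apply/funext => s; rewrite mxE.
Qed.

Lemma is_derive_er t (j : 'I_3) :
  is_derive t 1 (fun s : R => ortho_frame s idx_r 0 j) (ortho_frame t idx_theta 0 j).
Proof. by apply: is_derive_vec3. Qed.

Lemma is_derive_etheta t (j : 'I_3) :
  is_derive t 1 (fun s : R => ortho_frame s idx_theta 0 j) (- ortho_frame t idx_r 0 j).
Proof.
rewrite (_ : - _ = vec3 (- cos t) (- sin t) 0 0 j).
  by apply: is_derive_vec3.
by rewrite !mxE; case: j => -[|[|[|//]]] p /=; rewrite ?oppr0.
Qed.

Lemma is_derive_cyl_point_r r z t (j : 'I_3) :
  is_derive r 1 (fun s : R => cyl_point s z t 0 j) (ortho_frame t idx_r 0 j).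
Proof.
have lin (k : R) : is_derive r 1 (fun s : R => s * k) k.
  rewrite (_ : (fun s => _) = fun s : R => k * s); last by apply/funext => s; rewrite mulrC.
  by apply: (is_derive_eq (is_deriveZ k (is_derive_id r 1))); rewrite /GRing.scale /= mulr1.
by apply: is_derive_vec3.
Qed.

Lemma is_derive_cyl_point_z r z t (j : 'I_3) :
  is_derive z 1 (fun s : R => cyl_point r s t 0 j) (ortho_frame t idx_z 0 j).
Proof. by apply: is_derive_vec3. Qed.

Lemma is_derive_cyl_point_theta r z t (j : 'I_3) :
  is_derive t 1 (fun s : R => cyl_point r z s 0 j) ((r *: ortho_frame t idx_theta) 0 j).
Proof.
have -> : (r *: ortho_frame t idx_theta) 0 j = vec3 (r * - sin t) (r * cos t) 0 0 j.
  by rewrite !mxE; case: j => -[|[|[|//]]] p /=; rewrite ?mulr0.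
by apply: is_derive_vec3; exact: is_deriveZ.
Qed.

(** The frame does not turn along a ray, so only the new slot e_r from the moving point appears. *)
Lemma is_derive_component_r g b r z t : class_C b.+1 g ->
  is_derive r 1 (fun s : R => cyl_component g b 0 s z t) (cyl_component g b.+1 0 r z t).
Proof.
move=> gC; apply: is_derive_contract; last by move=> j; exact: is_derive_cyl_point_r.
by rewrite size_map cats0 size_nseq.
Qed.

Lemma is_derive_component_z g b r z t : class_C b.+1 g ->
  is_derive z 1 (fun s : R => cyl_component g b 0 r s t)
    (cyl_component (partial ord_max g) b 0 r z t).
Proof.
move=> gC; rewrite /cyl_component /cyl_contract -(contract_ez g t).
apply: is_derive_contract; last by move=> j; exact: is_derive_cyl_point_z.
by rewrite size_map cats0 size_nseq.
Qed.

Lemma is_derive_sumM n (e f : 'I_n -> R -> R) (de df : 'I_n -> R) t :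
  (forall j, is_derive t 1 (e j) (de j)) -> (forall j, is_derive t 1 (f j) (df j)) ->
  is_derive t 1 (fun s => \sum_(j < n) e j s * f j s)
    (\sum_(j < n) de j * f j t + \sum_(j < n) e j t * df j).
Proof.
move=> dej dfj; rewrite -big_split; apply: is_derive_sumr => j.
apply: (is_derive_eq (is_deriveM (dej j) (dfj j))).
by rewrite /GRing.scale /= addrC [f j t * _]mulrC.
Qed.

Lemma sumr_lin3 n (e b c d : 'I_n -> R) (k l m : R) :
  \sum_(j < n) e j * (k * b j + l * c j - m * d j) =
  k * (\sum_(j < n) e j * b j) + l * (\sum_(j < n) e j * c j)
  - m * (\sum_(j < n) e j * d j).
Proof.
rewrite !mulr_sumr -big_split -sumrB; apply: eq_bigr => j _ /=; ring.
Qed.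

(** Product rule over the slots: the moving point contributes r times a new e_theta, each of the [b]
    slots e_r turns into e_theta, each of the [n] slots e_theta into - e_r. The induction peels off
    one slot at a time. *)
Lemma is_derive_component_theta g b n r z t : class_C (b + n).+1 g ->
  is_derive t 1 (cyl_component g b n r z)
    (r * cyl_component g b n.+1 r z t + b%:R * cyl_component g b.-1 n.+1 r z t
     - n%:R * cyl_component g b.+1 n.-1 r z t).
Proof.
elim: b g => [|b IHb] g.
  elim: n g => [|n IHn] g gC.
    rewrite !mul0r subr0 addr0.
    have -> : r * cyl_component g 0 1 r z t =
        tensor_contract g [:: r *: ortho_frame t idx_theta] (cyl_point r z t).
      by rewrite contractZ.
    by apply: is_derive_contract => // j; exact: is_derive_cyl_point_theta.
  have dC (j : 'I_3) := IHn _ (class_C_partial j gC).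
  apply: (is_derive_eq (is_derive_sumM (is_derive_etheta t) dC)).
  rewrite sumr_lin3; under eq_bigr do rewrite mulNr.
  rewrite sumrN !mul0r !addr0.
  rewrite -[\sum_(i < 3) _]/(cyl_component g 1 n r z t).
  rewrite -[\sum_(i < 3) _ * cyl_component _ 0 _ _ _ _]/(cyl_component g 0 n.+2 r z t).
  (* For [n = 0] the coefficient makes both sides vanish; otherwise the theta slot in front moves
     past the r slot. *)
  have -> : n%:R * (\sum_(j < 3) ortho_frame t idx_theta 0 j *
      cyl_component (partial j g) 1 n.-1 r z t) = n%:R * cyl_component g 1 n r z t.
    case: n gC {IHn dC} => [|n] gC; first by rewrite !mul0r.
    congr (_ * _); apply: (@cyl_component_thetaS g 1 n).
    exact: class_C_le gC.
  by rewrite -natr1; ring.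
move=> gC.
have dC (j : 'I_3) := IHb _ (class_C_partial j gC).
apply: (is_derive_eq (is_derive_sumM (is_derive_er t) dC)).
rewrite sumr_lin3.
have -> : \sum_(j < 3) ortho_frame t idx_theta 0 j * cyl_component (partial j g) b n r z t =
    cyl_component g b n.+1 r z t.
  exact/cyl_component_thetaS/class_CS.
have -> : b%:R * (\sum_(j < 3) ortho_frame t idx_r 0 j *
    cyl_component (partial j g) b.-1 n.+1 r z t) = b%:R * cyl_component g b n.+1 r z t.
  by case: b {IHb gC dC} => [|b]; rewrite ?mul0r.
rewrite -[\sum_(j < 3) _ * cyl_component _ b n.+1 _ _ _]/(cyl_component g b.+1 n.+1 r z t).
rewrite -[\sum_(j < 3) _]/(cyl_component g b.+2 n.-1 r z t).
by rewrite -natr1 /=; ring.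
Qed.

Lemma periodic_cyl_contract g (s : seq cyl_index) r z :
  periodic (cyl_contract g s r z) (pi *+ 2).
Proof.
move=> t; have cosP : cos (t + pi *+ 2) = cos t by exact: cosD2pi.
have sinP : sin (t + pi *+ 2) = sin t by exact: sinD2pi.
rewrite /cyl_contract /cyl_point cosP sinP; congr tensor_contract.
by apply: eq_map => -[]; rewrite /= ?cosP ?sinP.
Qed.

(** * Iterated cylindrical operators as radial iterates of components *)

Lemma iter_d_r_over_rE m g c r z t : class_C m g -> (c <= m)%N -> 0 < r ->
  iter c d_r_over_r (in_cyl g) r z t =
  radial_iter r (fun k => cyl_component g k 0 r z t) c 0.
Proof.
move=> gC; elim: c r => [//|c IHc] r cm r0.
rewrite iterS /d_r_over_r {1}/d_r radial_iterE mul0r subr0; congr (_ * _).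
have dr : is_derive r 1
    (fun s => radial_iter s (fun k => cyl_component g k 0 s z t) c 0)
    (radial_iter r (fun k => cyl_component g k 0 r z t) c 1).
  apply: (@is_derive_radial_iter _ (fun k s => cyl_component g k 0 s z t) m).
  - by rewrite gt_eqF.
  - by move=> k km; apply: is_derive_component_r; exact: class_C_le gC.
  - by [].
(* The induction hypothesis covers positive radii only, so it is used on a neighbourhood of [r]. *)
rewrite derive1E -(@derive_val _ _ _ _ _ _ _ dr); apply: near_eq_derive.
near=> s; apply: IHc; first exact: ltnW.
by near: s; exact: lt_nbhsr.
Unshelve. all: by end_near. Qed.

Lemma iter_d_rE m g b c r z t : class_C m g -> (b + c <= m)%N -> 0 < r ->
  iter b d_r (iter c d_r_over_r (in_cyl g)) r z t =
  radial_iter r (fun k => cyl_component g k 0 r z t) c b.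
Proof.
move=> gC; elim: b r => [|b IHb] r bcm r0; first exact: iter_d_r_over_rE gC _ _.
rewrite iterS {1}/d_r.
have dr : is_derive r 1
    (fun s => radial_iter s (fun k => cyl_component g k 0 s z t) c b)
    (radial_iter r (fun k => cyl_component g k 0 r z t) c b.+1).
  apply: (@is_derive_radial_iter _ (fun k s => cyl_component g k 0 s z t) m).
  - by rewrite gt_eqF.
  - by move=> k km; apply: is_derive_component_r; exact: class_C_le gC.
  - by [].
rewrite derive1E -(@derive_val _ _ _ _ _ _ _ dr); apply: near_eq_derive.
near=> s; apply: IHb; first exact: ltnW.
by near: s; exact: lt_nbhsr.
Unshelve. all: by end_near. Qed.

(** At fixed r > 0 the inductive identity holds for every z, hence as an equality of functions, and
    the z-derivative passes through [radial_iter] as a parameter derivative. *)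
Lemma iter_d_zE a b c g r z t : class_C (a + (b + c)) g -> 0 < r ->
  iter a d_z (iter b d_r (iter c d_r_over_r (in_cyl g))) r z t =
  radial_iter r (fun k => cyl_component (iter a (partial ord_max) g) k 0 r z t) c b.
Proof.
move=> gC r0; elim: a z gC => [|a IHa] z gC; first exact: iter_d_rE gC _ _.
rewrite iterS {1}/d_z derive1E.
rewrite (_ : (fun s => _) = fun s => radial_iter r
    (fun k => cyl_component (iter a (partial ord_max) g) k 0 r s t) c b); last first.
  by apply/funext => s; apply: IHa; exact: class_CS.
apply: derive_val; apply: (@is_derive_radial_iter_param _
  (fun k s => cyl_component (iter a (partial ord_max) g) k 0 r s t)
  (fun k s => cyl_component (iter a.+1 (partial ord_max) g) k 0 r s t) (b + c)) => // k kbc.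
apply: is_derive_component_z; apply: class_C_le (_ : (k.+1 <= (b + c).+1)%N) _ => //.
by apply: class_C_iter_partial; rewrite addnS.
Qed.

End CylindricalComponents.

(* [n_theta] is 2 m_c: m_c is an integer iff [n_theta] is even, and then
   [m_c] below is n_theta / 2. *)
Theorem corollary2p3 (R : realType) (m : nat) (g : 'rV[R]_3 -> R)
    (iota : m.-tuple cyl_index) (hg : class_C m g) :
  let m_r := count is_r iota in
  let m_z := count is_z iota in
  let n_theta := count is_theta iota in
  let m_c := n_theta./2 in
  exists F : R -> R -> R -> R,
    [/\ forall r z : R, 0 < r -> periodic (F r z) (pi *+ 2),
        forall r z theta : R, 0 < r -> derivable (F r z) theta 1,
        forall r z theta : R, 0 < r ->
          nabla_contract g (cyl_point r z theta)
            (map_tuple (coord_frame r theta) iota) =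
          if ~~ odd n_theta then
            (double_fact (2 * m_c - 1))%:R * r ^+ (2 * m_c)
              * iter m_z d_z (iter m_r d_r (iter m_c d_r_over_r (in_cyl g)))
                  r z theta
            + d_theta F r z theta
          else d_theta F r z theta &
        forall r z theta : R, 0 < r ->
          nabla_contract g (cyl_point r z theta)
            (map_tuple (ortho_frame theta) iota) =
          if ~~ odd n_theta then
            (double_fact (2 * m_c - 1))%:R
              * iter m_z d_z (iter m_r d_r (iter m_c d_r_over_r (in_cyl g)))
                  r z theta
            + r ^- (2 * m_c) * d_theta F r z theta
          else r ^- n_theta * d_theta F r z theta].
Proof.
set m_r := count is_r iota; set m_z := count is_z iota.
set n := count is_theta iota; set m_c := n./2 => /=.
have countE : (m_z + (m_r + n) = m)%N.
  rewrite /m_z /m_r /n -[RHS](size_tuple iota); elim: (tval iota) => //= i l IHl.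
  by case: i; rewrite /= ?add0n ?add1n ?addnS ?addSn IHl.
pose h := iter m_z (partial ord_max) g.
have hC : class_C (m_r + n) h by apply: class_C_iter_partial; rewrite countE.
pose main r z t := if ~~ odd n then (double_fact (2 * m_c - 1))%:R *
  iter m_z d_z (iter m_r d_r (iter m_c d_r_over_r (in_cyl g))) r z t else 0.
have [Phi Phi_spec] : exists Phi : R -> R -> R -> R, forall r z : R, 0 < r ->
    periodic (Phi r z) (pi *+ 2) /\
    forall t : R, is_derive t 1 (Phi r z) (cyl_component h m_r n r z t - main r z t).
  have ex (r z : R) : exists F : R -> R, 0 < r -> periodic F (pi *+ 2) /\
      forall t : R, is_derive t 1 F (cyl_component h m_r n r z t - main r z t).
    (* For r <= 0 nothing is claimed, and [cst 0] is a default that makes the choice over all pairs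
       (r, z) total. *)
    have [r0|_] := ltP 0 r; last by exists (cst 0).
    have [||||F FP dF] := @theta_derivative_decomposition _
      (fun b n => cyl_component h b n r z) (m_r + n) r (pi *+ 2) _ _ _ m_r n.
    - by rewrite gt_eqF.
    - by move=> b k; exact: periodic_cyl_contract.
    - move=> b k t bk; apply: is_derive_component_theta; exact: class_C_le hC.
    - by [].
    exists F => _; split => // t; have := dF t; rewrite /main; case: ifP => // even_n.
    have mcE : (2 * m_c)%N = n by rewrite mul2n even_halfK.
    (* The main term takes m_z + m_r + m_c derivatives, at most [m] because m_c <= n. *)
    rewrite iter_d_zE ?mcE ?subn1//; apply: class_C_le hg.
    by rewrite -countE !leq_add2l -[leqRHS]mcE leq_pmull.
  have /choice[Phi2 Phi2P] (p : R * R) := ex p.1 p.2.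
  by exists (fun r z => Phi2 (r, z)) => r z; exact: Phi2P (r, z).
(* The [n] slots r e_theta of the coordinate frame give the weight r^n; the orthonormal form divides
   it out again. *)
exists (fun r z t : R => r ^+ n * Phi r z t).
have dF (r z t : R) : 0 < r -> is_derive t 1 (fun t : R => r ^+ n * Phi r z t)
    (r ^+ n * (cyl_component h m_r n r z t - main r z t)).
  by move=> /(Phi_spec r z)[_ dPhi]; exact: is_deriveZ.
have orthoE (r z t : R) : nabla_contract g (cyl_point r z t)
    (map_tuple (ortho_frame t) iota) = cyl_component h m_r n r z t.
  by rewrite nabla_contractE// [LHS]cyl_contractE// size_tuple.
have coordE (r z t : R) : nabla_contract g (cyl_point r z t)
    (map_tuple (coord_frame r t) iota) = r ^+ n * cyl_component h m_r n r z t.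
  by rewrite nabla_contractE// [LHS]contract_coord_frame -orthoE nabla_contractE.
have d_thetaE (r z t : R) : 0 < r -> d_theta (fun r z t : R => r ^+ n * Phi r z t) r z t =
    r ^+ n * (cyl_component h m_r n r z t - main r z t).
  move=> r0; rewrite /d_theta derive1E.
  exact: (@derive_val _ _ _ _ _ _ _ (dF r z t r0)).
split=> [r z r0 t|r z t r0|r z t r0|r z t r0].
- by have [PhiP _] := Phi_spec r z r0; rewrite PhiP.
- exact: (@ex_derive _ _ _ _ _ _ _ (dF r z t r0)).
- rewrite coordE d_thetaE// /main; case: (boolP (~~ odd n)) => [even_n|_];
    last by rewrite subr0.
  by rewrite mul2n even_halfK//; ring.
- have rn0 : r ^+ n != 0 by rewrite expf_neq0// gt_eqF.
  rewrite orthoE d_thetaE// /main; case: (boolP (~~ odd n)) => [even_n|_];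
    last by rewrite subr0 mulKf.
  by rewrite mul2n even_halfK// mulKf//; ring.
Qed.
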